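(* Let $l,r\in H'$. Then the mapping $$\mathcal F_{l,r}:\ \mathbb{R}^n_+\to\mathbb{R},\quad \mathcal F_{l,r}(\sigma):=r(u_\sigma^l)$$ fulfills $$\mathcal F_{l,r}(\sigma)=b_\sigma(u_\sigma^l,u_\sigma^r)\quad\text{for all }\sigma\in\mathbb{R}^n_+.$$ Moreover, $\mathcal F_{l,r}:\ \mathbb{R}^n_+\to\mathbb{R}$ is infinitely often differentiable and its first derivatives fulfill, for all $\sigma\in\mathbb{R}^n_+$ and $i=1,\ldots,n$, $$\frac{\partial}{\partial\sigma_i}\mathcal F_{l,r}(\sigma)=-b_i(u_\sigma^l,u_\sigma^r).$$
   Context: Setting: $H$ is a real Hilbert space and $H'=\mathcal L(H,\mathbb{R})$ is its dual. Let $n\in\mathbb{N}$ and let $b_0,b_1,\ldots,b_n:\ H\times H\to\mathbb{R}$ be bounded, symmetric and positive semidefinite bilinear forms. For $\sigma=(\sigma_1,\ldots,\sigma_n)\in\mathbb{R}^n$ set $$b_\sigma(u,v):=b_0(u,v)+\sum_{i=1}^n\sigma_i\, b_i(u,v).$$ With $\mathbf 1:=(1,\ldots,1)^T\in\mathbb{R}^n$, it is assumed that there are constants $\beta,C>0$ with $C\|v\|^2\ge b_{\mathbf 1}(v,v)\ge\beta\|v\|^2$ for all $v\in H$. $\mathbb{R}^n_+$ denotes the set of all $\sigma\in\mathbb{R}^n$ with all entries strictly positive; for such $\sigma$ the form $b_\sigma$ is symmetric, bounded and coercive, and for every functional $l\in H'$ (and likewise $r\in H'$) $u_\sigma^l\in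 H$ denotes the unique solution of $b_\sigma(u_\sigma^l,v)=l(v)$ for all $v\in H$. *)

(* Defs.v *)
From HB Require Import structures.
From mathcomp Require Import all_boot all_order all_algebra.
From mathcomp Require Import all_classical all_reals all_analysis.

Set Implicit Arguments.
Unset Strict Implicit.
Unset Printing Implicit Defensive.

Import Order.TTheory GRing.Theory Num.Theory.
Import numFieldNormedType.Exports.

Local Open Scope classical_set_scope.
Local Open Scope ring_scope.

(* A real Hilbert space is a complete normed space whose norm is induced by
   an inner product [ip : {dot H for idfun}] in this sense. *)
Definition induces_norm (R : realType) (H : normedModType R)
    (ip : H -> H -> R) : Prop :=
  forall v : H, `|v| ^+ 2 = ip v v.

Definition bounded_form (R : realType) (H : normedModType R)
    (b : H -> H -> R) : Prop :=
  exists M : R, forall u v : H, `|b u v| <= M * `|u| * `|v|.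

Definition psd_form (R : realType) (H : normedModType R)
    (b : H -> H -> R) : Prop :=
  forall v : H, 0 <= b v v.

Definition bsigma (R : realType) (H : normedModType R) (n : nat)
    (b0 : {symmetric H}) (b : 'I_n -> {symmetric H}) (sigma : 'rV[R]_n)
    (u v : H) : R :=
  b0 u v + \sum_(i < n) sigma 0 i * b i u v.

Definition posorthant (R : realType) (n : nat) : set 'rV[R]_n :=
  [set sigma | forall i : 'I_n, 0 < sigma 0 i].

Arguments posorthant R n : clear implicits.

(* u_sigma^l, by classical choice: the value is meaningful only where the
   variational equation is uniquely solvable, in particular (Lax-Milgram) for
   sigma in the positive orthant when b_(1,...,1) is coercive. *)
Definition usol (R : realType) (H : completeNormedModType R) (n : nat)
    (b0 : {symmetric H}) (b : 'I_n -> {symmetric H}) (l : H -> R)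
    (sigma : 'rV[R]_n) : H :=
  get [set u : H | forall v : H, bsigma b0 b sigma u v = l v].

Definition Flr (R : realType) (H : completeNormedModType R) (n : nat)
    (b0 : {symmetric H}) (b : 'I_n -> {symmetric H}) (l r : H -> R)
    (sigma : 'rV[R]_n) : R :=
  r (usol b0 b l sigma).

Definition iter_partial (R : realType) (n : nat) (s : seq 'I_n)
    (f : 'rV[R]_n -> R) : 'rV[R]_n -> R :=
  foldr (fun (i : 'I_n) (g : 'rV[R]_n -> R) => 'D_('e_i) g) f s.

(* Intended for open [U]: [f] and all its partial derivatives of all orders
   are (Frechet) differentiable, hence continuous, at every point of [U]; the
   values of [f] outside [U] are then irrelevant. *)
Definition infinitely_differentiable_on (R : realType) (n : nat)
    (U : set 'rV[R]_n) (f : 'rV[R]_n -> R) : Prop :=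
  forall (s : seq 'I_n) (x : 'rV[R]_n), U x ->
    differentiable (iter_partial s f) x.

(* Main.v *)
(* Let Phi be a parameter-dependent right-hand side in the dual of H, with
   gradient (G_j)_j, and let Y(sigma) solve b_sigma(Y, v) = Phi(sigma)(v).
   Subtracting the equations at two parameters and using coercivity shows that Y
   is Frechet differentiable and that its j-th partial derivative solves the
   same equation with right-hand side G_j - b_j(Y, .).  The right-hand sides
   obtained from constant functionals by the operations Phi |-> b_j(Y_Phi, .)
   and differences are therefore stable under partial differentiation, which
   gives smoothness by induction on the order.  For constant Phi = l the first
   derivative is -r(D) with b_sigma(D, .) = b_i(u^l, .), and testing this
   equation with u^r gives the formula. *)
Require Import Defs.
From HB Require Import structures.
From mathcomp Require Import all_boot all_order all_algebra.
From mathcomp Require Import all_classical all_reals all_analysis.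
From mathcomp Require Import ring lra.

Set Implicit Arguments.
Unset Strict Implicit.
Unset Printing Implicit Defensive.

Import Order.TTheory GRing.Theory Num.Theory.
Import numFieldNormedType.Exports.

Local Open Scope classical_set_scope.
Local Open Scope ring_scope.

(** * Bounded linear functionals *)

Definition bounded_functional (R : realType) (H : normedModType R)
    (phi : H -> R) : Prop :=
  scalar phi /\ exists M : R, forall v, `|phi v| <= M * `|v|.

Section Scalar.
Context (R : realType) (H : normedModType R) (phi : H -> R).
Hypothesis phiL : scalar phi.

Lemma scalarB u v : phi (u - v) = phi u - phi v.
Proof. by rewrite -scaleN1r addrC phiL mulN1r addrC. Qed.

Lemma scalar0 : phi 0 = 0.
Proof. by rewrite -[0](subrr 0) scalarB subrr. Qed.

Lemma scalarD u v : phi (u + v) = phi u + phi v.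
Proof. by rewrite -[u]scale1r phiL mul1r scale1r. Qed.

Lemma scalarZ a u : phi (a *: u) = a * phi u.
Proof. by rewrite -[_ *: _]addr0 phiL scalar0 addr0. Qed.

Lemma scalar_sum n (f : 'I_n -> H) :
  phi (\sum_i f i) = \sum_i phi (f i).
Proof. exact: (big_morph phi scalarD scalar0). Qed.

End Scalar.

(** * Solvability of symmetric coercive variational equations *)

Section LaxMilgram.
Context (R : realType) (H : completeNormedModType R) (a : H -> H -> R).
Hypothesis aC : forall u v, a u v = a v u.
Hypothesis aL : forall v, scalar (a ^~ v).
Hypothesis a_bounded : bounded_form a.
Context (alpha : R).
Hypothesis alpha_gt0 : 0 < alpha.
Hypothesis a_coercive : forall v, alpha * `|v| ^+ 2 <= a v v.

(** Testing with [v = w] and cancelling one factor [|w|]. This turns every bound on a right-hand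
    side in the dual norm into a bound on the solution. *)
Lemma coercive_norm_le (w : H) (k : R) : 0 <= k ->
  (forall v, `|a w v| <= k * `|v|) -> alpha * `|w| <= k.
Proof.
move=> k0 awk; have [->|w0] := eqVneq w 0; first by rewrite normr0 mulr0.
have nw : 0 < `|w| by rewrite normr_gt0.
rewrite -(ler_pM2r nw) -mulrA -expr2.
apply: (le_trans (a_coercive w)); apply: le_trans (awk w).
exact: ler_norm.
Qed.

(* A minimizing sequence of [J v = a v v - 2 phi v] is Cauchy by the
   parallelogram identity, so completeness of [H] is all that is needed: no
   Riesz representation, hence no inner product. *)
Lemma lax_milgram (phi : H -> R) : bounded_functional phi ->
  exists u, forall v, a u v = phi v.
Proof.
move=> [phiL [M phiM]].
have a_ge0 v : 0 <= a v v.
  by apply: le_trans (a_coercive v); rewrite mulr_ge0 ?sqr_ge0 ?ltW.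
have aLr u : scalar (a u).
  by move=> k v w; rewrite aC aL !(aC u).
pose J v := a v v - 2 * phi v.
have JE u v t : J (u + t *: v) = J u + 2 * t * (a u v - phi v) + t ^+ 2 * a v v.
  rewrite /J (scalarD phiL) (scalarZ phiL) !(scalarD (aL _)) !(scalarZ (aL _)).
  by rewrite !(scalarD (aLr _)) !(scalarZ (aLr _)) (aC v u); ring.
(* Coercivity gives [J v >= alpha |v|^2 - 2 M |v|]; complete the square. *)
have J_ge v : - (M ^+ 2 / alpha) <= J v.
  have h1 := a_coercive v; have h2 := le_trans (ler_norm _) (phiM v).
  rewrite /J -mulNr ler_pdivrMr//.
  have := sqr_ge0 (alpha * `|v| - M).
  have := ler_wpM2l (ltW alpha_gt0) h1; have := ler_wpM2l (ltW alpha_gt0) h2.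
  by lra.
pose m := inf (range J).
have Jinf : has_inf (range J).
  split; first by exists (J 0), 0.
  by exists (- (M ^+ 2 / alpha)) => _ [v _ <-].
have Jm v : m <= J v by apply: ge_inf; [exact: Jinf.2|exists v].
have /choice[u uJ] : forall k : nat, exists u, J u < m + k.+1%:R^-1.
  move=> k; have [|_ [u _ <-] Ju] := @inf_adherent _ (range J) k.+1%:R^-1 _ Jinf.
    by rewrite invr_gt0.
  by exists u.
(* Both [w] and the midpoint of [v] and [w] lie on the line through [v] in direction [v - w], so
   [JE] yields the parallelogram identity; [J] is at least [m] at the midpoint. *)
have midJ v w : alpha * `|v - w| ^+ 2 <= 2 * (J v - m) + 2 * (J w - m).
  apply: (le_trans (a_coercive _)).
  have := Jm (v + (- 2^-1) *: (v - w)); rewrite JE.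
  have -> : J w = J (v + (- 1) *: (v - w)).
    by congr (J _); rewrite scaleN1r opprB addrC subrK.
  by rewrite JE; lra.
have u_cvg : cvg (u @ \oo).
  apply/cauchy_cvgP/cauchy_exP => e e0.
  (* Both excesses [J - m] will be below this value, so [midJ] bounds [alpha |u k - u j|^2] by four
     times it, that is by [alpha e^2]. *)
  have ae : 0 < alpha * e ^+ 2 / 4 by rewrite divr_gt0// mulr_gt0// exprn_gt0.
  have [k _ /= kP] := near_infty_natSinv_lt (PosNum ae).
  exists (u k); exists k => //= j /= kj; rewrite -ball_normE /=.
  have := midJ (u k) (u j); have := uJ k; have := uJ j.
  have := kP _ kj; have := kP _ (leqnn k) => /=.
  move=> h1 h2 h3 h4 h5.
  rewrite -(@ltr_pXn2r _ 2%N) ?nnegrE ?normr_ge0 ?ltW// -(ltr_pM2l alpha_gt0).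
  by move: (k.+1%:R^-1) (j.+1%:R^-1) h1 h2 h3 h4 h5 => x y; lra.
exists (lim (u @ \oo)) => v; apply/subr0_eq/eqP; rewrite -normr_le0.
set w := lim _; have [N aN] := a_bounded.
(* Half of [e] pays for replacing the limit by [u k], the other half for the residual of [u k]. The
   added 1 in the denominators avoids division by zero. *)
apply/ler_addgt0Pl => e e0; rewrite addr0.
have u_near : \forall k \near \oo, `|w - u k| < e / 2 / (`|N| * `|v| + 1).
  apply: cvgr_dist_lt; first exact: u_cvg.
  by rewrite !divr_gt0// ltr_wpDl// mulr_ge0.
have e1 : 0 < (e / 2) ^+ 2 / (a v v + 1).
  by rewrite divr_gt0 ?exprn_gt0 ?divr_gt0 ?ltr_wpDl.
have : \forall k \near \oo, k.+1%:R^-1 < (PosNum e1)%:num.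
  exact: near_infty_natSinv_lt.
move=> /(filterI u_near) /filter_ex [k [uk /= kk]].
have -> : a w v - phi v = a (w - u k) v + (a (u k) v - phi v).
  by rewrite (scalarB (aL v)); ring.
rewrite (le_trans (ler_normD _ _))// [leRHS]splitr lerD//.
  apply: (le_trans (aN _ _)).
  move: uk; rewrite ltr_pdivlMr ?ltr_wpDl ?mulr_ge0//.
  have := ler_norm N; have := normr_ge0 (w - u k); have := normr_ge0 v.
  have := normr_ge0 N; set x := `|w - _|; set y := `|v|; set n := `|N|.
  by move=> n0 y0 x0 Nn h; have := ler_wpM2r (mulr_ge0 x0 y0) Nn; nra.
set d := a _ v - _.
have A1 : 0 < a v v + 1 by rewrite ltr_wpDl.
have d2 : d ^+ 2 <= (e / 2) ^+ 2.
  (* A near-minimizer is nearly stationary: a step of length [- d / (a v v + 1)] along [v] lowers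
     [J] by at least [d^2 / (a v v + 1)], yet [J (u k)] exceeds [m] by less than [1 / (k + 1)]. *)
  have := Jm (u k + (- d / (a v v + 1)) *: v); rewrite JE -/d => Jd.
  have kA : k.+1%:R^-1 * (a v v + 1) < (e / 2) ^+ 2 by rewrite -ltr_pdivlMr.
  apply: le_trans (ltW kA).
  rewrite -ler_pdivrMr//.
  have -> : d ^+ 2 / (a v v + 1) =
    - (2 * (- d / (a v v + 1)) * d + (- d / (a v v + 1)) ^+ 2 * a v v) - 
     (d / (a v v + 1)) ^+ 2.
    by field; rewrite gt_eqF.
  move: (uJ k) (sqr_ge0 (d / (a v v + 1))) Jd.
  by move: (k.+1%:R^-1) => x; lra.
rewrite -(@ler_pXn2r _ 2%N) ?nnegrE ?divr_ge0 ?(ltW e0)//.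
by rewrite real_normK ?num_real.
Qed.

End LaxMilgram.

(** * The positive orthant and coordinate estimates *)

(** The cap at 1 lets [m] also serve as a factor for [b0], whose coefficient is 1; it is the value
    of the minimum when [n = 0]. *)
Lemma posorthantE (R : realType) (n : nat) (sigma : 'rV[R]_n) :
  posorthant R n sigma <-> exists2 m, 0 < m <= 1 & forall i, m <= sigma 0 i.
Proof.
split=> [sp|[m /andP[m0 _] ms] i]; last exact: lt_le_trans (ms i).
exists (\big[Order.min/1]_(i < n) sigma 0 i).
  by rewrite bigmin_le_id andbT lt_bigmin// => i _; exact: sp.
by move=> i; exact: bigmin_le_cond.
Qed.

Lemma ler_coord_norm (R : realType) (n : nat) (h : 'rV[R]_n) (i : 'I_n) :
  `|h 0 i| <= `|h|.
Proof.
rewrite [leRHS]/Num.norm /= mx_normrE.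
by apply/bigmax_geP; right => /=; exists (0, i).
Qed.

Lemma norm_sum_coord_le (R : realType) (n : nat) (h : 'rV[R]_n)
    (V : normedModType R) (c : 'I_n -> V) :
  `|\sum_j h 0 j *: c j| <= `|h| * \sum_j `|c j|.
Proof.
rewrite mulr_sumr; apply: (le_trans (ler_norm_sum _ _ _)).
by apply: ler_sum => j _; rewrite normrZ ler_wpM2r// ler_coord_norm.
Qed.

Lemma near_posorthant (R : realType) (n : nat) (x : 'rV[R]_n) :
  posorthant R n x -> \forall y \near x, posorthant R n y.
Proof.
move=> /posorthantE[m /andP[m0 _] mx].
apply/nbhs_normP; exists m => //= y /= xy i.
have := ler_coord_norm (x - y) i; rewrite !mxE => h.
have := le_lt_trans (ler_norm _) (le_lt_trans h xy).
by have := mx i; lra.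
Qed.

(** * Gradients of vector-valued maps *)

(** Frechet differentiability as an explicit inequality, the form in which the coercivity estimates
    deliver it; [gradient_diff] translates it back. *)
Definition has_gradient (R : realType) (n : nat) (V : normedModType R)
    (f : 'rV[R]_n -> V) (x : 'rV[R]_n) (G : 'I_n -> V) : Prop :=
  forall e : R, 0 < e -> \forall y \near x,
    `|f y - f x - \sum_j (y - x) 0 j *: G j| <= e * `|y - x|.

Lemma is_diff_of_remainder (R : realType) (U V : normedModType R) (f : U -> V)
    (df : {linear U -> V}) (x : U) : continuous df ->
  (forall e : R, 0 < e -> \forall y \near x,
     `|f y - f x - df (y - x)| <= e * `|y - x|) ->
  differentiable f x /\ 'd f x = df :> (U -> V).
Proof.
move=> dfc fdf.
have fx : f \o shift x = cst (f x) + df +o_ 0 id.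
  apply/eqaddoP => e e0; rewrite near_simpl.
  have := fdf e e0; rewrite (near_shift 0) => /=; apply: filterS => h /=.
  by rewrite subr0 addrK opprD addrA.
split; last exact: diff_unique dfc fx.
by apply/diff_locallyP; rewrite (diff_unique dfc fx).
Qed.

Section Gradient.
Context (R : realType) (n : nat) (V : normedModType R).
Implicit Types (x : 'rV[R]_n) (G : 'I_n -> V).

Definition gradient_map G (h : 'rV[R]_n) : V :=
  \sum_j h 0 j *: G j.

Lemma gradient_map_linear G : linear (gradient_map G).
Proof.
move=> a u v; rewrite /gradient_map scaler_sumr -big_split.
by apply: eq_bigr => j _; rewrite !mxE scalerDl scalerA.
Qed.

HB.instance Definition _ G :=
  GRing.isLinear.Build R 'rV[R]_n V *:%R (gradient_map G) (gradient_map_linear G).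

Lemma gradient_map_continuous G : continuous (gradient_map G).
Proof.
apply: bounded_linear_continuous; apply/linear_boundedP.
near=> k => h; apply: (le_trans (norm_sum_coord_le _ _)).
rewrite mulrC ler_wpM2r//; near: k; exact: nbhs_pinfty_ge.
Unshelve. all: by end_near. Qed.

Lemma gradient_diff (f : 'rV[R]_n -> V) x G : has_gradient f x G ->
  differentiable f x /\ forall j, 'D_('e_j) f x = G j.
Proof.
move=> fG.
have [d df] := is_diff_of_remainder (@gradient_map_continuous G) fG.
split=> // j; rewrite deriveE// df /= /gradient_map (bigD1 j)//=.
rewrite mxE !eqxx scale1r big1 ?addr0// => i ij.
by rewrite mxE (negPf ij) andbF scale0r.
Qed.

(** Formulas for iterated derivatives are known only on the open orthant; this allows them to be
    differentiated there. *)
Lemma eq_near_gradient (f g : 'rV[R]_n -> V) x G :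
  (\forall y \near x, f y = g y) -> has_gradient f x G -> has_gradient g x G.
Proof.
move=> fg fG e e0; have fgx := nbhs_singleton fg.
by apply: filterS2 fg (fG e e0) => y <-; rewrite -fgx.
Qed.

Lemma gradient_comp (r : V -> R) (f : 'rV[R]_n -> V) x G :
  bounded_functional r -> has_gradient f x G ->
  has_gradient (r \o f) x (r \o G).
Proof.
move=> [rL [M rM]] fG e e0.
have M1 : 0 < `|M| + 1 by rewrite ltr_wpDl.
have := fG (e / (`|M| + 1)); rewrite divr_gt0// => /(_ isT); apply: filterS => y h.
rewrite /= -(scalarB rL).
under eq_bigr do rewrite -[_ *: _]/(_ * _) -(scalarZ rL).
rewrite -(scalar_sum rL) -(scalarB rL); apply: (le_trans (rM _)).
apply: (@le_trans _ _ ((`|M| + 1) * (e / (`|M| + 1) * `|y - x|))).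
  apply: le_trans (ler_wpM2l (ltW M1) h); apply: ler_wpM2r => //.
  by rewrite (le_trans (ler_norm M))// lerDl.
by rewrite !mulrA (mulrC _ e) mulfK ?gt_eqF.
Qed.

End Gradient.

(** * The parametrized variational equation *)

Section Smoothness.
Context (R : realType) (H : completeNormedModType R) (n : nat).
Context (b0 : {symmetric H}) (b : 'I_n -> {symmetric H}).
Hypotheses (b0_bounded : bounded_form b0) (b_bounded : forall i, bounded_form (b i)).
Hypotheses (b0_psd : psd_form b0) (b_psd : forall i, psd_form (b i)).
Context (beta : R).
Hypothesis beta_gt0 : 0 < beta.
Hypothesis b1_ge : forall v, beta * `|v| ^+ 2 <= bsigma b0 b (const_mx 1) v v.

Local Notation U := (posorthant R n).
Local Notation bs := (bsigma b0 b).
Local Notation sol phi x := (usol b0 b phi x).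
Implicit Types (x y : 'rV[R]_n) (u v w : H).

Lemma bsigmaC x u v : bs x u v = bs x v u.
Proof.
have sC (c : {symmetric H}) w z : c w z = c z w.
  by rewrite hermC /= expr0 mul1r.
by rewrite /bsigma sC; congr (_ + _); apply: eq_bigr => i _; rewrite sC.
Qed.

Lemma bsigma_linear x v : scalar (bs x ^~ v).
Proof.
move=> k u w; rewrite /bsigma linearPl mulrDr mulr_sumr addrACA; congr (_ + _).
by rewrite -big_split; apply: eq_bigr => i _; rewrite linearPl /=; ring.
Qed.

(** The form is affine in the parameter, so this expansion has no remainder. *)
Lemma bsigma_shift x y u v :
  bs y u v = bs x u v + \sum_j (y - x) 0 j * b j u v.
Proof.
rewrite /bsigma -addrA -big_split; congr (_ + _).
by apply: eq_bigr => i _; rewrite !mxE /=; ring.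
Qed.

Lemma sum_form_bounded : exists2 B : R, 0 <= B &
  forall (h : 'rV[R]_n) u v,
    `|\sum_j h 0 j * b j u v| <= `|h| * (B * `|u| * `|v|).
Proof.
have [M bM] := choice b_bounded; exists (\sum_j `|M j|) => [|h u v].
  exact: sumr_ge0.
apply: (le_trans (norm_sum_coord_le (V := R) h (fun j => b j u v))).
apply: ler_wpM2l => //; rewrite !mulr_suml; apply: ler_sum => j _.
apply: (le_trans (bM j u v)); do 2! apply: ler_wpM2r => //.
exact: ler_norm.
Qed.

Lemma bsigma_bounded x : bounded_form (bs x).
Proof.
have [M bM] := b0_bounded; have [B B0 bB] := sum_form_bounded.
exists (M + `|x| * B) => u v; apply: (le_trans (ler_normD _ _)).
apply: (le_trans (lerD (bM u v) (bB x u v))).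
by rewrite le_eqVlt; apply/predU1P; left; ring.
Qed.

(** With [m] from [posorthantE], positive semidefiniteness of each form gives
    [bs x v v >= m * bs (const_mx 1) v v]. *)
Lemma bsigma_coercive x : U x ->
  exists2 alpha : R, 0 < alpha & forall v, alpha * `|v| ^+ 2 <= bs x v v.
Proof.
move=> /posorthantE[m /andP[m0 m1] mx]; exists (m * beta); first exact: mulr_gt0.
move=> v; rewrite -mulrA; apply: le_trans (ler_wpM2l (ltW m0) (b1_ge v)) _.
rewrite /bsigma mulrDr mulr_sumr; apply: lerD.
  by rewrite ler_piMl.
apply: ler_sum => i _; rewrite mxE mul1r; apply: ler_wpM2r; first exact: b_psd.
exact: mx.
Qed.

Lemma usolP x phi : U x -> bounded_functional phi ->
  forall v, bs x (sol phi x) v = phi v.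
Proof.
move=> /bsigma_coercive[alpha a0 ac] phiB.
have ex := lax_milgram (bsigmaC x) (bsigma_linear x) (bsigma_bounded x) a0 ac phiB.
by rewrite /usol; exact: (getPex ex).
Qed.

Lemma form_bounded_functional j w : bounded_functional (b j w).
Proof.
split=> [k u v|]; first by rewrite linearPr.
by have [M bM] := b_bounded j; exists (M * `|w|).
Qed.

Lemma bounded_functionalB (phi psi : H -> R) :
  bounded_functional phi -> bounded_functional psi ->
  bounded_functional (fun v => phi v - psi v).
Proof.
move=> [pL [M pM]] [qL [N qN]]; split=> [k u v|].
  by rewrite pL qL; ring.
exists (M + N) => v; apply: (le_trans (ler_normB _ _)).
by rewrite mulrDl lerD.
Qed.

Lemma bounded_functional0 : bounded_functional (fun _ : H => 0 : R).
Proof.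
split=> [k u v|]; first by rewrite mulr0 addr0.
by exists 0 => v; rewrite normr0 mul0r.
Qed.

(** * Differentiability of the solution in the parameter *)

(* The remainder is small uniformly over the unit ball of [H], i.e. [G] is the
   gradient of [Phi] as a map into the dual of [H] with its operator norm. *)
Definition has_dual_gradient (Phi : 'rV[R]_n -> H -> R) x (G : 'I_n -> H -> R) :=
  forall e : R, 0 < e -> \forall y \near x, forall v,
    `|Phi y v - Phi x v - \sum_j (y - x) 0 j * G j v| <= e * `|y - x| * `|v|.

Lemma dual_gradient_cst phi x : has_dual_gradient (fun=> phi) x (fun _ _ => 0).
Proof.
move=> e e0; apply: (@filterE _ (nbhs x)) => y v.
rewrite subrr big1 ?subr0 ?normr0 => [|j _]; last by rewrite mulr0.
by rewrite !mulr_ge0// ltW.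
Qed.

(** The increment [d] of the solution is first shown to be of order [|h|]. The coupling term
    [b_j(d, .)] weighted by [h] is then of second order, and what remains of the error comes from
    the remainder of [Phi]. *)
Lemma usol_gradient Phi x G : U x ->
  (forall y, U y -> bounded_functional (Phi y)) ->
  (forall j, bounded_functional (G j)) ->
  has_dual_gradient Phi x G ->
  has_gradient (fun y => sol (Phi y) y) x
    (fun j => sol (fun v => G j v - b j (sol (Phi x) x) v) x).
Proof.
move=> Ux PhiB GB PhiG e e0.
have [alpha a0 ac] := bsigma_coercive Ux.
have [B B0 bB] := sum_form_bounded.
have [N GN] := choice (fun j => (GB j).2).
pose N1 := \sum_j `|N j|; have N0 : 0 <= N1 by exact: sumr_ge0.
set u := sol (Phi x) x; pose D j := sol (fun v => G j v - b j u v) x.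
have DE j v : bs x (D j) v = G j v - b j u v.
  apply: usolP => //; apply: bounded_functionalB => //.
  exact: form_bounded_functional.
(* The final error has two contributions of size [e1 |h|], and coercivity divides their sum by
   [alpha]. *)
pose e1 := alpha * e / 2; have e10 : 0 < e1 by rewrite divr_gt0 ?mulr_gt0.
(* Bounds, per unit of [|h|], the source terms of the equation for [d]: remainder of [Phi], its
   gradient, and the forms applied to [u]. *)
pose K := e1 + N1 + B * `|u|.
have K0 : 0 < K by rewrite /K -addrA ltr_wpDr// addr_ge0// mulr_ge0.
(* The radius [d1] makes [|h| B] at most [alpha / 2], so that the coupling term is absorbed; [d2]
   then forces [B |d| <= e1]. *)
have d1 : 0 < alpha / 2 / (B + 1) by rewrite !divr_gt0// ltr_wpDl.
have d2 : 0 < alpha / 2 * e1 / (B * K + 1).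
  by rewrite !divr_gt0 ?mulr_gt0 ?divr_gt0// ltr_wpDl// mulr_ge0// ltW.
near=> y.
have Uy : U y by near: y; exact: near_posorthant.
have Phie : forall v, `|Phi y v - Phi x v - \sum_j (y - x) 0 j * G j v|
    <= e1 * `|y - x| * `|v|.
  by near: y; exact: PhiG.
set h := y - x in Phie *.
have hN : `|h| = `|x - y| by rewrite distrC.
have h1 : `|h| * (B + 1) < alpha / 2.
  by rewrite -ltr_pdivlMr ?ltr_wpDl// hN; near: y; exact: cvgr_dist_lt.
have h2 : `|h| * (B * K + 1) < alpha / 2 * e1.
  rewrite -ltr_pdivlMr; last by rewrite ltr_wpDl// mulr_ge0// ltW.
  by rewrite hN; near: y; exact: cvgr_dist_lt.
set d := sol (Phi y) y - u.
(* The equation at [y] minus the one at [x], with the form at [y] expanded around [x]. *)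
have dE v : bs x d v = (Phi y v - Phi x v - \sum_j h 0 j * G j v)
    + \sum_j h 0 j * (G j v - b j u v) - \sum_j h 0 j * b j d v.
  have := usolP Uy (PhiB _ Uy) v; rewrite (bsigma_shift x) => /eqP.
  rewrite eq_sym -subr_eq => /eqP yE.
  rewrite (scalarB (bsigma_linear x v)) -yE (usolP Ux (PhiB _ Ux)).
  have -> : \sum_j h 0 j * b j (sol (Phi y) y) v =
      \sum_j h 0 j * b j d v + \sum_j h 0 j * b j u v.
    rewrite -big_split; apply: eq_bigr => j _ /=.
    by rewrite -mulrDr -linearDl subrK.
  have -> : \sum_j h 0 j * (G j v - b j u v) =
      \sum_j h 0 j * G j v - \sum_j h 0 j * b j u v.
    by rewrite -sumrB; apply: eq_bigr => j _; rewrite mulrBr.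
  by rewrite -/h; ring.
have sumG v : `|\sum_j h 0 j * G j v| <= `|h| * (N1 * `|v|).
  apply: (le_trans (norm_sum_coord_le (V := R) h (fun j => G j v))).
  apply: ler_wpM2l => //; rewrite mulr_suml; apply: ler_sum => j _.
  by apply: (le_trans (GN j v)); apply: ler_wpM2r => //; exact: ler_norm.
have d_le : alpha / 2 * `|d| <= `|h| * K.
  have : alpha * `|d| <= `|h| * K + `|h| * (B * `|d|).
    apply: (coercive_norm_le ac) => [|v].
      by rewrite addr_ge0 ?mulr_ge0// ltW.
    rewrite dE.
    have -> : \sum_j h 0 j * (G j v - b j u v) =
        \sum_j h 0 j * G j v - \sum_j h 0 j * b j u v.
      by rewrite -sumrB; apply: eq_bigr => j _; rewrite mulrBr.
    move: (Phie v) (sumG v) (bB h u v) (bB h d v).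
    set A1 := _ - _ - _; set A2 := \sum_j _; set A3 := \sum_j _; set A4 := \sum_j _.
    move=> H1 H2 H3 H4; rewrite /K.
    apply: (le_trans (ler_normB _ _)).
    apply: (le_trans (lerD (ler_normD _ _) (lexx _))).
    apply: (le_trans (lerD (lerD H1 (ler_normB _ _)) H4)).
    by lra.
  have : `|h| * B * `|d| <= alpha / 2 * `|d|.
    by apply: ler_wpM2r => //; have := normr_ge0 h; lra.
  by lra.
have Bd : B * `|d| <= e1.
  rewrite -(@ler_pM2l _ (alpha / 2)) ?divr_gt0//.
  by have := ler_wpM2l B0 d_le; have := normr_ge0 h; lra.
rewrite -(ler_pM2l a0).
apply: (@le_trans _ _ (`|h| * (e1 + e1))); last by rewrite /e1; lra.
apply: (coercive_norm_le ac) => [|v]; first by rewrite mulr_ge0// addr_ge0// ltW.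
rewrite (scalarB (bsigma_linear x v)) (scalar_sum (bsigma_linear x v)).
under [X in _ - X]eq_bigr do rewrite (scalarZ (bsigma_linear x v)) DE.
(* The linear part of [dE] cancels against the equations of the [D j], leaving the remainder of
   [Phi] and the coupling term. *)
rewrite dE addrAC addrK.
apply: (le_trans (ler_normB _ _)).
apply: (le_trans (lerD (Phie v) (bB h d v))).
rewrite mulrDr mulrDl; apply: lerD; first by rewrite (mulrC e1).
by rewrite -(mulrA _ e1); apply: ler_wpM2l => //; apply: ler_wpM2r.
Unshelve. all: by end_near. Qed.

(** * Iterated partial derivatives *)

(* Right-hand sides of the variational equations solved by the iterated partial
   derivatives of [u_sigma^l]. *)
Inductive iterated_rhs : ('rV[R]_n -> H -> R) -> Prop :=
| IterConst phi : bounded_functional phi -> iterated_rhs (fun=> phi)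
| IterForm j Phi : iterated_rhs Phi ->
    iterated_rhs (fun x => b j (sol (Phi x) x))
| IterSub Phi Psi : iterated_rhs Phi -> iterated_rhs Psi ->
    iterated_rhs (fun x v => Phi x v - Psi x v).

Lemma iterated_rhs_bounded Phi x :
  iterated_rhs Phi -> bounded_functional (Phi x).
Proof.
elim=> [//|j Psi _ _|Psi Xi _ PsiB _ XiB]; first exact: form_bounded_functional.
exact: bounded_functionalB.
Qed.

(** The right-hand sides [G j - b_j(u, .)] from [usol_gradient] stay in the class. The gradient of
    [Phi] is a hypothesis because the inductive proof of [iterated_rhs_gradient] applies this to the
    inner right-hand side. *)
Lemma iterated_rhs_usol_gradient Phi (G : 'I_n -> 'rV[R]_n -> H -> R) :
  iterated_rhs Phi -> (forall j, iterated_rhs (G j)) ->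
  (forall x, U x -> has_dual_gradient Phi x (G^~ x)) ->
  exists2 D : 'I_n -> 'rV[R]_n -> H -> R, (forall j, iterated_rhs (D j)) &
    forall x, U x -> has_gradient (fun y => sol (Phi y) y) x
      (fun j => sol (D j x) x).
Proof.
move=> CPhi CG PhiG.
exists (fun j x v => G j x v - b j (sol (Phi x) x) v) => [j|x Ux].
  by apply: IterSub => //; exact: IterForm.
apply: usol_gradient => // [y _|j|]; last exact: PhiG.
  exact: iterated_rhs_bounded.
exact: iterated_rhs_bounded.
Qed.

(** Constants have gradient zero and differences are treated termwise. For [IterForm], the solution
    is differentiated and [w |-> b j w], a bounded linear map into the dual, is applied to its
    remainder. *)
Lemma iterated_rhs_gradient Phi : iterated_rhs Phi ->
  exists2 G : 'I_n -> 'rV[R]_n -> H -> R, (forall j, iterated_rhs (G j)) &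
    forall x, U x -> has_dual_gradient Phi x (G^~ x).
Proof.
elim=> [phi phiB|j Psi CPsi [G CG PsiG]|Psi Xi CPsi [G CG PsiG] CXi [K CK XiK]].
- exists (fun _ _ _ => 0) => [j|x _]; last exact: dual_gradient_cst.
  exact: IterConst bounded_functional0.
- have [D CD PsiD] := iterated_rhs_usol_gradient CPsi CG PsiG.
  exists (fun k x => b j (sol (D k x) x)) => [k|x Ux e e0]; first exact: IterForm.
  have [M bM] := b_bounded j; have M1 : 0 < `|M| + 1 by rewrite ltr_wpDl.
  have := PsiD x Ux (e / (`|M| + 1)); rewrite divr_gt0// => /(_ isT).
  apply: filterS => y h v.
  have -> : b j (sol (Psi y) y) v - b j (sol (Psi x) x) v -
      \sum_k (y - x) 0 k * b j (sol (D k x) x) v =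
    b j (sol (Psi y) y - sol (Psi x) x -
      \sum_k (y - x) 0 k *: sol (D k x) x) v.
    rewrite !linearBl /= linear_sumlz; congr (_ - _); apply: eq_bigr => k _.
    by rewrite linearZl_LR.
  apply: (le_trans (bM _ _)); apply: ler_wpM2r => //.
  apply: (@le_trans _ _ ((`|M| + 1) * (e / (`|M| + 1) * `|y - x|))).
    apply: le_trans (ler_wpM2l (ltW M1) h); apply: ler_wpM2r => //.
    by rewrite (le_trans (ler_norm M))// lerDl.
  by rewrite !mulrA (mulrC _ e) mulfK ?gt_eqF.
- exists (fun j x v => G j x v - K j x v) => [j|x Ux e e0]; first exact: IterSub.
  have e2 : 0 < e / 2 by rewrite divr_gt0.
  apply: filterS2 (PsiG x Ux _ e2) (XiK x Ux _ e2) => y h1 h2 v.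
  have -> : \sum_j (y - x) 0 j * (G j x v - K j x v) =
      \sum_j (y - x) 0 j * G j x v - \sum_j (y - x) 0 j * K j x v.
    by rewrite -sumrB; apply: eq_bigr => j _; rewrite mulrBr.
  have -> (p q p' q' s t : R) : p - q - (p' - q') - (s - t) =
      (p - p' - s) - (q - q' - t) by ring.
  apply: (le_trans (ler_normB _ _)); apply: (le_trans (lerD (h1 v) (h2 v))).
  by rewrite -2!mulrDl -splitr.
Qed.

(** Each further partial derivative only replaces the right-hand side by another member of the
    class. The equality is claimed on [U] alone, where [usol] solves its equation. *)
Lemma iter_partial_usol (r : H -> R) Phi s :
  bounded_functional r -> iterated_rhs Phi ->
  exists2 Psi : 'rV[R]_n -> H -> R, iterated_rhs Psi &
    forall x, U x ->
      iter_partial s (fun y => r (sol (Phi y) y)) x = r (sol (Psi x) x).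
Proof.
move=> rB CPhi; elim: s => [|i s [Psi CPsi PsiE]]; first by exists Phi.
have [G CG PsiG] := iterated_rhs_gradient CPsi.
have [D CD PsiD] := iterated_rhs_usol_gradient CPsi CG PsiG.
exists (D i) => // x Ux /=.
have /gradient_diff[_ ->//] : has_gradient
    (iter_partial s (fun y => r (sol (Phi y) y))) x (fun j => r (sol (D j x) x)).
  apply: eq_near_gradient (gradient_comp rB (PsiD x Ux)).
  by apply: filterS (near_posorthant Ux) => y Uy; rewrite PsiE.
Qed.

Lemma usol_infinitely_differentiable (r l : H -> R) :
  bounded_functional r -> bounded_functional l ->
  infinitely_differentiable_on U (Flr b0 b l r).
Proof.
move=> rB lB s x Ux.
have [Psi CPsi PsiE] := iter_partial_usol s rB (IterConst lB).
have [G CG PsiG] := iterated_rhs_gradient CPsi.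
have [D CD PsiD] := iterated_rhs_usol_gradient CPsi CG PsiG.
have /gradient_diff[] // : has_gradient
    (iter_partial s (Flr b0 b l r)) x (fun j => r (sol (D j x) x)).
apply: eq_near_gradient (gradient_comp rB (PsiD x Ux)).
by apply: filterS (near_posorthant Ux) => y Uy; exact: esym (PsiE y Uy).
Qed.

(** * The energy formula and the first derivatives *)

Lemma Flr_bsigma (r l : H -> R) x :
  bounded_functional r -> bounded_functional l -> U x ->
  Flr b0 b l r x = bs x (sol l x) (sol r x).
Proof. by move=> rB lB Ux; rewrite bsigmaC usolP. Qed.

Lemma Flr_is_derive (r l : H -> R) x i :
  bounded_functional r -> bounded_functional l -> U x ->
  is_derive x 'e_i (Flr b0 b l r) (- b i (sol l x) (sol r x)).
Proof.
move=> rB lB Ux.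
have [d D] := gradient_diff (gradient_comp rB
  (usol_gradient Ux (fun _ _ => lB) (fun=> bounded_functional0)
    (dual_gradient_cst l x))).
split; first exact: diff_derivable.
(* The derivative is [r] of the solution with right-hand side [0 - b_i(u^l, .)]. Rewrite [r] through
   the equation of [u^r], swap the arguments by symmetry, and use the equation of that derivative at
   [u^r]. *)
rewrite -[LHS]/('D_('e_i) _ x) D /= -(usolP Ux rB) bsigmaC usolP//.
  by rewrite sub0r.
exact: bounded_functionalB bounded_functional0 (form_bounded_functional i _).
Qed.

End Smoothness.

Lemma continuous_bounded_functional (R : realType) (H : normedModType R)
    (l : {linear H -> R}) : continuous l -> bounded_functional l.
Proof.
move=> l_cont; split=> [a u v|]; first by rewrite linearP.
have /linear_boundedP/pinfty_ex_gt0[M _ lM] := continuous_linear_bounded 0 (l_cont 0).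
by exists M.
Qed.

Theorem corollary1 (R : realType) (H : completeNormedModType R)
    (ip : {dot H for idfun}) (Hip : induces_norm ip)
    (n : nat) (b0 : {symmetric H}) (b : 'I_n -> {symmetric H})
    (b0_bounded : bounded_form b0) (b_bounded : forall i, bounded_form (b i))
    (b0_psd : psd_form b0) (b_psd : forall i, psd_form (b i))
    (beta C : R) (beta_gt0 : 0 < beta) (C_gt0 : 0 < C)
    (b1_le : forall v : H, bsigma b0 b (const_mx 1) v v <= C * `|v| ^+ 2)
    (b1_ge : forall v : H, beta * `|v| ^+ 2 <= bsigma b0 b (const_mx 1) v v)
    (l r : {linear H -> R}) (l_cont : continuous l) (r_cont : continuous r) :
  let bs := bsigma b0 b in
  let u := usol b0 b in
  let F := Flr b0 b l r in
  [/\ (forall sigma, posorthant R n sigma ->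
         F sigma = bs sigma (u l sigma) (u r sigma)),
      infinitely_differentiable_on (posorthant R n) F
    & (forall sigma, posorthant R n sigma -> forall i : 'I_n,
         is_derive sigma 'e_i F (- b i (u l sigma) (u r sigma)))].
Proof.
have lB := continuous_bounded_functional l_cont.
have rB := continuous_bounded_functional r_cont.
move=> bs u F; split=> [sigma sp||sigma sp i].
- exact: (Flr_bsigma b0_bounded b_bounded b0_psd b_psd beta_gt0 b1_ge rB lB sp).
- exact: (usol_infinitely_differentiable b0_bounded b_bounded b0_psd b_psd
    beta_gt0 b1_ge rB lB).
- exact: (Flr_is_derive b0_bounded b_bounded b0_psd b_psd beta_gt0 b1_ge i
    rB lB sp).
Qed.
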